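(* Let $D$ be a maximal Arrow's single-peaked domain on a set $A$ with extremal paths $P$ and $\theta(P)$, where $\theta$ is a permutation of $A$. If there exist distinct $x,x',a\in A$ such that $\theta(x)=x'$, $\theta(a)=a$ and $P(\{x,x',a\})=(x,x',a)$, then $D$ is not self-paired.
   Context: A linear order on a finite set $A$ of size $m$ is identified with a directed Hamilton path through $A$, i.e. a sequence $(a_1,\dots,a_m)$ listing every element of $A$ exactly once (most preferred first). For a path $P$ and $S\subseteq A$, $P(S)$ denotes the path on $S$ obtained from $P$ by deleting the elements of $A\setminus S$. A set $D$ of linear orders on $A$ is a Condorcet domain if there are no three orders in $D$ and distinct $a_1,a_2,a_3\in A$ such that the three orders rank these elements as $a_1\succ a_2\succ a_3$, $a_2\succ a_3\succ a_1$, $a_3\succ a_1\succ a_2$ respectively. It is maximal if it is not properly contained in another Condorcet domain on $A$. An Arrow's single-peaked domain is a Condorcet domain $D$ such that every triple (3-element subset) $T\subseteq A$ has a ''never-bottom'' element, i.e. an element of $T$ which no order of $D$ ranks last among the elements of $T$. A maximal Arrow's single-peaked domain is an Arrow's single-peaked domain which is maximal as a Condorcet domain. A terminal vertex of $D$ is an element which is last in some order of $D$; a maximal Arrow's single-peaked domain has exactly two terminal vertices. A path in $D$ is extremal if it starts at one terminal vertex and ends at the other; such a $D$ has exactly two extremal paths. Permutations act on paths entrywise. If $P$ and $\theta(P)$ are the two extremal paths of $D$, then $\theta$ (which swaps the two terminal vertices) is the inherited permutation of $D$, and $D$ is self-paired if $\{\theta(W):W\in D\}=D$. *)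

(* Defs.v *)
From HB Require Import structures.
From mathcomp Require Import all_boot all_fingroup.

Set Implicit Arguments.
Unset Strict Implicit.
Unset Printing Implicit Defensive.

(* A duplicate-free tuple of length #|A| lists every element of A exactly
   once, most preferred element first. *)
Record linorder (A : finType) : predArgType :=
  LinOrder { lo_tuple :> #|A|.-tuple A; lo_uniq : uniq lo_tuple }.

HB.instance Definition _ (A : finType) := [isSub for @lo_tuple A].
HB.instance Definition _ (A : finType) := [Finite of linorder A by <:].

Section Domains.

Variable A : finType.
Implicit Types (D E : {set linorder A}) (W P : linorder A) (S T : {set A}).

(* The path P(S). *)
Definition restrict P S : seq A := [seq y <- P | y \in S].

Definition condorcet_domain D : Prop :=
  forall (W1 W2 W3 : linorder A) (a1 a2 a3 : A),
    W1 \in D -> W2 \in D -> W3 \in D -> uniq [:: a1; a2; a3] ->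
    ~ [/\ restrict W1 [set a1; a2; a3] = [:: a1; a2; a3],
          restrict W2 [set a1; a2; a3] = [:: a2; a3; a1]
        & restrict W3 [set a1; a2; a3] = [:: a3; a1; a2]].

Definition maximal_condorcet_domain D : Prop :=
  condorcet_domain D /\
  (forall E, condorcet_domain E -> ~~ (D \proper E)).

(* Below, the default value of head and last is never reached: the sequences
   they are applied to contain x (resp. u, v). *)
Definition never_bottom D T (x : A) : Prop :=
  x \in T /\ forall W, W \in D -> last x (restrict W T) != x.

Definition arrow_single_peaked D : Prop :=
  condorcet_domain D /\
  (forall T, #|T| = 3 -> exists x, never_bottom D T x).

Definition maximal_arrow_single_peaked D : Prop :=
  arrow_single_peaked D /\ maximal_condorcet_domain D.

Definition terminal D (x : A) : Prop :=
  exists2 W, W \in D & last x W = x.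

Definition extremal D W : Prop :=
  W \in D /\
  exists u v : A,
    [/\ terminal D u, terminal D v, u != v, head u W = u & last v W = v].

Fact perm_path_uniq (theta : {perm A}) W : uniq (map_tuple theta W).
Proof. by rewrite /= (map_inj_uniq perm_inj) lo_uniq. Qed.

Definition perm_path (theta : {perm A}) W : linorder A :=
  LinOrder (perm_path_uniq theta W).

(* Used with theta the inherited permutation of D, i.e. with P and
   perm_path theta P the two extremal paths of D; exchanging the roles of the
   two extremal paths replaces theta by its inverse, which gives the same
   notion. *)
Definition self_paired D (theta : {perm A}) : Prop :=
  [set perm_path theta W | W in D] = D.

End Domains.

(* Main.v *)
Require Import Defs.
From mathcomp Require Import all_boot all_fingroup.

(** Suppose that [D] is self-paired. All images of [P] under powers of [theta]
then lie in [D] and start at terminal vertices of [D].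

There are at most two terminal vertices, since among three of them the
never-bottom element would be last in some order ([terminal_pigeonhole]), and
a path of [D] is determined by its initial vertex when this is terminal
([eq_path_from_terminal]). Hence two of the three paths [P], [theta P] and
[theta (theta P)] coincide. As [theta] is not the identity, these are the
outer two, so [theta] is an involution. It therefore exchanges [x] and [x'],
fixes [a], and maps the triple [{x, x', a}] to itself.

The never-bottom element of this triple is not [a], by the hypothesis on [P];
it is [x] or [x'], and by the symmetry under [theta] both of them are
never-bottom. So [a] is last of the triple in every order of [D]. This
contradicts maximality, because in a maximal domain no element is last of a
triple in every order ([exists_other_bottom]).

The last fact rests on [exchange_last]: if [W] is in [D] and [S] is the set of
vertices of an initial segment of [W] that has at least two vertices and ends
at [a], then the segment can be replaced by another path on [S], one that does
not end at [a]. Indeed, if every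
order of [D] had [a] last in [S], then exchanging [a] with its predecessor [y]
in [W] would affect only the triples [{p, y, a}] with [p] in [S], in which [p]
is never-bottom both before and after; the new order could be added to [D].
As long as [a] is last in the triple, such replacements move it up, so at some
point another element of the triple comes below it. *)

Set Implicit Arguments.
Unset Strict Implicit.
Unset Printing Implicit Defensive.

(** * Sequences *)

Section Sequences.

Variable T : eqType.
Implicit Types s : seq T.

Lemma cat_pair s x y r : s ++ [:: x, y & r] = (s ++ [:: x; y]) ++ r.
Proof. by rewrite -catA. Qed.

Lemma last_nonempty x y z s : z \in s -> last x s = last y s.
Proof. by case: s. Qed.

Lemma last_filter_cat (p : pred T) x y s1 s2 r :
  has p r -> last x (filter p (s1 ++ r)) = last y (filter p (s2 ++ r)).
Proof.
rewrite has_filter !filter_cat !last_cat; by case: (filter p r).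
Qed.

Lemma last_filter_cons (p : pred T) x s c r :
  p c -> ~~ has p r -> last x (filter p (s ++ c :: r)) = c.
Proof.
by move=> pc; rewrite has_filter negbK filter_cat /= pc last_cat => /eqP ->.
Qed.

Lemma last_difference s1 s2 :
  size s1 = size s2 -> s1 != s2 ->
  exists c1 c2 t1 t2 r,
    [/\ s1 = t1 ++ c1 :: r, s2 = t2 ++ c2 :: r & c1 != c2].
Proof.
elim/last_ind: s1 s2 => [|s1 x IH] s2; first by case: s2.
case/lastP: s2 => [|s2 y]; first by rewrite size_rcons.
rewrite !size_rcons => -[eq_sz] neq.
have [eq_xy | neq_xy] := eqVneq x y; last first.
  by exists x, y, s1, s2, [::]; rewrite !cats1.
have /(IH _ eq_sz) [c1 [c2 [t1 [t2 [r [-> -> neq_c]]]]]] : s1 != s2.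
  by apply: contra neq => /eqP ->; rewrite eq_xy.
by exists c1, c2, t1, t2, (rcons r y); rewrite eq_xy !rcons_cat.
Qed.

End Sequences.

(** * Linear orders *)

Section Orders.

Variable A : finType.
Implicit Types (D : {set linorder A}) (W P Q : linorder A) (S T : {set A}).

Lemma mem_linorder W x : x \in (W : seq A).
Proof.
have /card_uniqP sz := lo_uniq W.
have /subset_leqif_cards := subsetT [set y in (W : seq A)].
rewrite cardsT cardsE sz size_tuple => -[_].
by rewrite eqxx => /esym/eqP/setP/(_ x); rewrite !inE.
Qed.

Lemma linorder_of_seq W (s : seq A) :
  perm_eq s W -> exists W' : linorder A, W' = s :> seq A.
Proof.
move=> sW; have sz : size s == #|A| by rewrite (perm_size sW) size_tuple.
have us : uniq (Tuple sz) by rewrite /= (perm_uniq sW) lo_uniq.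
by exists (LinOrder us).
Qed.

Lemma linorder_inj P Q : P = Q :> seq A -> P = Q.
Proof. by move=> eqPQ; do 2!apply: val_inj. Qed.

Lemma last_restrict_default W T x y z :
  z \in T -> last x (restrict W T) = last y (restrict W T).
Proof.
move=> zT; apply: (@last_nonempty _ _ _ z).
by rewrite mem_filter zT mem_linorder.
Qed.

Lemma last_restrict_mem W T x : x \in T -> last x (restrict W T) \in T.
Proof.
move=> xT; have := mem_last x (restrict W T).
by rewrite inE => /orP[/eqP -> //|]; rewrite mem_filter => /andP[].
Qed.

Lemma card_triple (a b c : A) : uniq [:: a; b; c] -> #|[set a; b; c]| = 3.
Proof.
rewrite /= !inE negb_or -!andbA => /and3P[ab ac /andP[bc _]].
by rewrite setUC cardsU1 cards2 !inE negb_or ab eq_sym ac eq_sym bc.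
Qed.

(** Two of the elements of a triple may be named; this provides the third. *)
Lemma third_element T x y :
  #|T| = 3 -> exists2 z, z \in T & (z != x) && (z != y).
Proof.
move=> cT; have : 0 < #|T :\: [set x; y]|.
  have := cardsID [set x; y] T; rewrite cT => eT.
  rewrite -(ltn_add2l #|T :&: [set x; y]|) addn0 eT.
  by rewrite (leq_ltn_trans (subset_leq_card (subsetIr _ _))) // cards2; case: eqP.
by case/card_gt0P => z; rewrite !inE negb_or => /andP[? ?]; exists z.
Qed.

Lemma last_perm_path (theta : {perm A}) W T z :
  (forall y, (theta y \in T) = (y \in T)) ->
  last (theta z) (restrict (perm_path theta W) T)
    = theta (last z (restrict W T)).
Proof.
move=> thetaT; rewrite /restrict /= filter_map last_map; congr (theta (last z _)).
by apply: eq_filter => y; apply: thetaT.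
Qed.

Lemma perm_path_fix (theta : {perm A}) W y :
  perm_path theta W = W -> theta y = y.
Proof.
move=> fixW; have : map theta W = map id W.
  by rewrite map_id -{2}fixW.
by move/eq_in_map/(_ y (mem_linorder W y)).
Qed.

Lemma self_paired_perm_path D (theta : {perm A}) W :
  self_paired D theta -> W \in D -> perm_path theta W \in D.
Proof. by move=> sp WD; have := imset_f (perm_path theta) WD; rewrite sp. Qed.

Lemma terminal_perm_path D (theta : {perm A}) u :
  self_paired D theta -> terminal D u -> terminal D (theta u).
Proof.
move=> sp [W WD lastW]; exists (perm_path theta W).
  exact: self_paired_perm_path.
by rewrite /= last_map lastW.
Qed.

(** * Arrow's single-peaked domains *)

(** A cyclic triple of orders puts each of its three elements last once. *)
Lemma never_bottom_condorcet D :
  (forall T, #|T| = 3 -> exists x, never_bottom D T x) -> condorcet_domain D.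
Proof.
move=> nb W1 W2 W3 a b c D1 D2 D3 uabc [E1 E2 E3].
have [z [zT nz]] := nb _ (card_triple uabc).
move: (nz _ D1) (nz _ D2) (nz _ D3); rewrite E1 E2 E3 /=.
by move: zT; rewrite !inE -orbA => /or3P[] /eqP ->; rewrite eqxx.
Qed.

Lemma never_bottom_triple D (a b c : A) :
  arrow_single_peaked D -> uniq [:: a; b; c] ->
  (exists2 W, W \in D & last a (restrict W [set a; b; c]) = a) ->
  (exists2 W, W \in D & last b (restrict W [set a; b; c]) = b) ->
  (exists2 W, W \in D & last c (restrict W [set a; b; c]) = c) -> False.
Proof.
move=> [_ nb] uabc [W1 D1 E1] [W2 D2 E2] [W3 D3 E3].
have [z [zT nz]] := nb _ (card_triple uabc).
move: (nz _ D1) (nz _ D2) (nz _ D3) zT; rewrite !inE.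
move=> n1 n2 n3; rewrite -orbA.
by case/or3P=> /eqP ez; move: n1 n2 n3; rewrite ez ?E1 ?E2 ?E3 eqxx.
Qed.

Lemma last_restrict_last W T u :
  u \in T -> last u W = u -> last u (restrict W T) = u.
Proof.
move=> uT; rewrite /restrict; case/lastP: (tval W) => [//|s y].
by rewrite last_rcons => ->; rewrite filter_rcons uT last_rcons.
Qed.

(** Of three terminal vertices two coincide, as otherwise each of them would
be last in their triple. *)
Lemma terminal_pigeonhole D (a b c : A) :
  arrow_single_peaked D -> terminal D a -> terminal D b -> terminal D c ->
  ~~ uniq [:: a; b; c].
Proof.
move=> asp [W1 D1 E1] [W2 D2 E2] [W3 D3 E3]; apply/negP => uabc.
apply: (never_bottom_triple asp uabc).
- by exists W1 => //; rewrite last_restrict_last // !inE eqxx ?orbT.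
- by exists W2 => //; rewrite last_restrict_last // !inE eqxx ?orbT.
- by exists W3 => //; rewrite last_restrict_last // !inE eqxx ?orbT.
Qed.

(** If two such paths differ, let [c1] and [c2] be their entries at the last
place where they differ. The paths have the same vertices up to this place,
so [c1] and [c2] are last in the triple [{c1, c2, u}] in one of them each,
and [u] is last in an order that ends at [u]. *)
Lemma eq_path_from_terminal D P Q u :
  arrow_single_peaked D -> P \in D -> Q \in D -> terminal D u ->
  head u P = u -> head u Q = u -> P = Q.
Proof.
move=> asp PD QD [W WD lastW] hP hQ; apply: linorder_inj; apply/eqP.
apply: contraT => neq.
have eq_sz : size P = size Q by rewrite !size_tuple.
have [c1 [c2 [t1 [t2 [r [eP eQ neqc]]]]]] := last_difference eq_sz neq.
have sub s c t : uniq (s ++ c :: t) -> head u (s ++ c :: t) = u ->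
    u \notin t /\ (c = u -> s = [::]).
  case: s => [|h s] /=.
    by case/andP => ct _ ec; split=> //; rewrite -ec.
  rewrite mem_cat inE !negb_or -andbA => /and3P[_ /andP[hc ht] _] eh.
  by split=> [|ec]; [rewrite -eh | rewrite eh ec eqxx in hc].
have uP : uniq (t1 ++ c1 :: r) by rewrite -eP lo_uniq.
have uQ : uniq (t2 ++ c2 :: r) by rewrite -eQ lo_uniq.
rewrite eP in hP; rewrite eQ in hQ.
have [ur n1] := sub _ _ _ uP hP; have [_ n2] := sub _ _ _ uQ hQ.
have sz12 : size t1 = size t2.
  by move: eq_sz; rewrite eP eQ !size_cat /= => /addIn.
have c1u : c1 != u.
  apply: contra neqc => /eqP ec1; move: hQ.
  by rewrite (size0nil (_ : size t2 = 0)) /= ?ec1 => [->|] //; rewrite -sz12 n1.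
have c2u : c2 != u.
  apply: contra neqc => /eqP ec2; move: hP.
  by rewrite (size0nil (_ : size t1 = 0)) /= ?ec2 => [->|] //; rewrite sz12 n2.
have c1r : c1 \notin r.
  by move: uP; rewrite cat_uniq /= => /and3P[_ _ /andP[]].
have c2r : c2 \notin r.
  by move: uQ; rewrite cat_uniq /= => /and3P[_ _ /andP[]].
have Tr : ~~ has (mem [set c1; c2; u]) r.
  apply/hasPn => y yr; rewrite /= !inE -orbA; apply/negP.
  by case/or3P=> /eqP ey; move: yr; rewrite ey; apply/negP.
case: (@never_bottom_triple D c1 c2 u asp).
- by rewrite /= !inE negb_or neqc c1u c2u.
- by exists P => //; rewrite /restrict eP last_filter_cons // !inE eqxx.
- by exists Q => //; rewrite /restrict eQ last_filter_cons // !inE eqxx orbT.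
- by exists W => //; rewrite last_restrict_last // !inE eqxx orbT.
Qed.

(** * Consequences of maximality *)

Lemma maximal_mem D W :
  maximal_arrow_single_peaked D ->
  (forall T, #|T| = 3 ->
     exists2 x, never_bottom D T x & last x (restrict W T) != x) ->
  W \in D.
Proof.
move=> [_ [_ maxD]] nb; apply: contraT => WD.
suff /maxD/negP[] : condorcet_domain (W |: D) by rewrite properUr // sub1set.
apply: never_bottom_condorcet => T /nb[x [xT nx] lW]; exists x; split=> // W'.
by rewrite !inE => /orP[/eqP -> // | /nx].
Qed.

(** The never-bottom conditions only see which element is last in each
triple. *)
Lemma maximal_mem_same_bottom D W :
  maximal_arrow_single_peaked D ->
  (forall T x, x \in T -> exists2 W', W' \in D &
     last x (restrict W T) = last x (restrict W' T)) ->
  W \in D.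
Proof.
move=> mD same; apply: (maximal_mem mD) => T /(mD.1.2) [x [xT nx]].
by exists x => //; have [W' /nx ? ->] := same _ _ xT.
Qed.

(** The contrapositive is the exchange argument: if every order
of [D] had [a] last among [V ++ [:: y; a]], then exchanging [y] and [a] in [W]
would give an order that is not in [D] but could be added to it. *)
Lemma some_order_avoids_last D W V y a (R : seq A) :
  maximal_arrow_single_peaked D -> W \in D -> W = V ++ [:: y, a & R] :> seq A ->
  exists2 W', W' \in D &
    last a (restrict W' [set z in V ++ [:: y; a]]) != a.
Proof.
move=> mD WD eW; set S := [set z in _].
case: (pickP (fun W' => (W' \in D) && (last a (restrict W' S) != a))).
  by move=> W' /andP[]; exists W'.
move=> noW.
have alast W' : W' \in D -> last a (restrict W' S) = a.
  by move=> W'D; have := noW W'; rewrite /= W'D => /negbFE/eqP.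
have uW : uniq (V ++ [:: y, a & R]) by rewrite -eW lo_uniq.
have ya : y != a.
  by move: uW; rewrite uniq_catC /= inE negb_or => /andP[/andP[]].
have [W1 eW1] : exists W1 : linorder A, W1 = V ++ [:: a, y & R] :> seq A.
  apply: (@linorder_of_seq W); rewrite eW perm_cat2l.
  by rewrite -(cat1s a) -(cat1s y) perm_catCA.
have SR : ~~ has (mem S) R.
  have : uniq ((V ++ [:: y; a]) ++ R) by rewrite -cat_pair.
  rewrite cat_uniq => /and3P[_ /hasPn dis _]; apply/hasPn => z /dis.
  by rewrite /= inE.
have W1D : W1 \in D.
  apply: (maximal_mem mD) => T cT.
  case: (boolP [&& y \in T, a \in T & ~~ has (mem T) R]) => [|generic].
    case/and3P => yT aT TR.
    (* In such a triple every order of [D] has [a] last and [W1] has [y] last,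
       so the third element is never-bottom. *)
    have [p pT /andP[py pa]] := third_element y a cT.
    have TS z : z \in T -> z \in S.
      move=> zT; have := mem_linorder W z; rewrite eW.
      rewrite cat_pair mem_cat => /orP[|zR].
        by rewrite inE.
      by case/hasP: TR; exists z.
    exists p; last first.
      rewrite /restrict eW1 -cat_rcons last_filter_cons //.
      by rewrite eq_sym.
    split=> // W' /alast aW'.
    rewrite (last_restrict_default W' p a pT).
    have -> : restrict W' T = [seq z <- restrict W' S | z \in T].
      rewrite /restrict -filter_predI; apply: eq_filter => z /=.
      by case zT: (z \in T) => //=; rewrite TS.
    move: aW'; case/lastP: (restrict W' S) => [|s b].
      by rewrite /= eq_sym.
    by rewrite last_rcons => ->; rewrite filter_rcons aT last_rcons eq_sym.
  (* In all other triples [W1] and [W] have the same last element. *)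
  have [x nx] := mD.1.2 _ cT; exists x => //.
  suff -> : last x (restrict W1 T) = last x (restrict W T) by apply: nx.2.
  rewrite /restrict eW1 eW.
  case: (boolP (has (mem T) R)) generic => [TR _|_].
    by rewrite (cat_pair V a) (cat_pair V y); apply: last_filter_cat.
  by rewrite andbT !filter_cat /=; case: (y \in T); case: (a \in T).
move: (alast _ W1D); rewrite /restrict eW1 -cat_rcons last_filter_cons //.
  by move/eqP; rewrite (negPf ya).
by rewrite !inE mem_cat !inE eqxx orbT.
Qed.

(** Placing the restriction to [V ++ [:: y; a]] of an order of [D] above the
end [R] of another one gives an order whose bottom in each triple is that of
one of the two. *)
Lemma exchange_last D W V y a (R : seq A) :
  maximal_arrow_single_peaked D -> W \in D -> W = V ++ [:: y, a & R] :> seq A ->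
  exists W' V', [/\ W' \in D, W' = V' ++ R :> seq A,
    perm_eq V' (V ++ [:: y; a]) & last a V' != a].
Proof.
move=> mD WD eW; have [W1 W1D nlast] := some_order_avoids_last mD WD eW.
set S := [set z in _] in nlast; set V' := restrict W1 S in nlast.
have uW : uniq ((V ++ [:: y; a]) ++ R) by rewrite -cat_pair -eW lo_uniq.
have pV' : perm_eq V' (V ++ [:: y; a]).
  apply: uniq_perm; first by rewrite filter_uniq ?lo_uniq.
    by move: uW; rewrite cat_uniq => /andP[].
  by move=> z; rewrite mem_filter mem_linorder andbT inE.
have [W' eW'] : exists W' : linorder A, W' = V' ++ R :> seq A.
  by apply: (@linorder_of_seq W); rewrite eW cat_pair perm_cat2r.
exists W', V'; split=> //.
apply: (maximal_mem_same_bottom mD) => T x xT.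
case: (boolP (has (mem T) R)) => [TR | TR].
  exists W => //; rewrite /restrict eW' eW.
  by rewrite cat_pair; apply: last_filter_cat.
exists W1 => //; rewrite /restrict eW' filter_cat.
have /eqP -> : [seq z <- R | z \in T] == [::].
  by move: TR; rewrite has_filter negbK.
rewrite cats0 -filter_predI; congr last; apply: eq_filter => z /=.
case zT: (z \in T) => //=; have := mem_linorder W z; rewrite eW.
rewrite cat_pair mem_cat => /orP[|zR]; first by rewrite inE.
by case/hasP: TR; exists z.
Qed.

(** As long as [a] is last in [T], [exchange_last] yields an order of [D] in
which [a] has a smaller position. *)
Lemma exists_other_bottom D W T a b :
  maximal_arrow_single_peaked D -> W \in D ->
  a \in T -> b \in T -> b != a ->
  exists2 W', W' \in D & last a (restrict W' T) != a.
Proof.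
move=> mD WD aT bT neq.
have [n] := ubnP (index a W); elim: n W WD => // n IH W WD ltn.
have [lastW | ] := eqVneq (last a (restrict W T)) a; last by exists W.
have [V [R eW]] : exists V R, W = V ++ a :: R :> seq A.
  by case/splitPr: (mem_linorder W a) => V R; exists V, R.
have uW : uniq (V ++ a :: R) by rewrite -eW lo_uniq.
have [aV aR] : a \notin V /\ a \notin R.
  by move: uW; rewrite uniq_catC /= mem_cat negb_or => /andP[/andP[]].
have TR : ~~ has (mem T) R.
  apply/negP => TR; move: lastW; rewrite /restrict eW -cat_rcons.
  rewrite (@last_filter_cat _ _ a a _ [::] R TR) /=.
  move: TR; rewrite has_filter; case eR: (filter _ R) => [|z s] // _ /= lasta.
  have : a \in filter (mem T) R by rewrite eR -lasta mem_last.
  by rewrite mem_filter (negPf aR) andbF.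
have bV : b \in V.
  have := mem_linorder W b; rewrite eW mem_cat inE (negPf neq) /=.
  by case/orP=> // bR; case/hasP: TR; exists b.
case/lastP: V bV => // V y _ in eW aV uW *.
rewrite cat_rcons in eW.
have [W' [V' [W'D eW' pV' lastV']]] := exchange_last mD WD eW.
apply: (IH W') => //.
have aV' : a \in V' by rewrite (perm_mem pV') mem_cat !inE eqxx !orbT.
have : index a V' < (size V').-1.
  case/lastP: V' aV' lastV' {eW' pV'} => // s c.
  rewrite mem_rcons inE last_rcons size_rcons -cats1 eq_sym => /orP[-> // | asc].
  by rewrite index_cat asc index_mem.
rewrite eW' index_cat aV' (perm_size pV') size_cat addn2 /= => lt_a.
move: ltn; rewrite eW -cat_rcons index_cat (negPf aV) size_rcons /= eqxx addn0.
by rewrite ltnS; apply: leq_trans.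
Qed.

End Orders.

(** * Self-paired domains *)

Theorem corollary5p8 (A : finType) (D : {set linorder A})
    (P : linorder A) (theta : {perm A}) :
  maximal_arrow_single_peaked D ->
  extremal D P ->
  extremal D (perm_path theta P) ->
  (exists x x' a : A,
     [/\ uniq [:: x; x'; a], theta x = x', theta a = a
       & restrict P [set x; x'; a] = [:: x; x'; a]]) ->
  ~ self_paired D theta.
Proof.
move=> mD [PD [u [v [tu tv _ hP _]]]] _ [x [x' [a [uT tx ta eP]]]] sp.
have asp := mD.1.
have head_theta (W : linorder A) w : head w W = w ->
    head (theta w) (perm_path theta W) = theta w.
  by rewrite /=; case: (tval W) => //= ? ? ->.
have [neqx xa] : x' != x /\ x != a.
  by move: uT; rewrite /= !inE negb_or eq_sym -andbA => /and3P[].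
have ttu := terminal_perm_path sp tu.
have tttu := terminal_perm_path sp ttu.
have htP := head_theta _ _ hP; have httP := head_theta _ _ htP.
have tPD := self_paired_perm_path sp PD.
have ttPD := self_paired_perm_path sp tPD.
have neq_tu : theta u != u.
  apply: contra neqx => /eqP eu; rewrite eu in htP.
  have /esym fixP := eq_path_from_terminal asp PD tPD tu hP htP.
  by rewrite -tx (perm_path_fix x fixP).
have ttu_u : theta (theta u) = u.
  have := terminal_pigeonhole asp tu ttu tttu.
  rewrite /= !inE negb_or eq_sym neq_tu /= andbT negb_and !negbK.
  by rewrite (inj_eq perm_inj) eq_sym (eq_sym u) (negPf neq_tu) orbF => /eqP.
have tx' : theta x' = x.
  rewrite ttu_u in httP.
  have eqPP := eq_path_from_terminal asp PD ttPD tu hP httP.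
  have : map theta (map theta P) = map id P by rewrite map_id {2}eqPP.
  by rewrite -map_comp => /eq_in_map/(_ x (mem_linorder P x)) /=; rewrite tx.
set T := [set x; x'; a] in eP.
have [xT x'T aT] : [/\ x \in T, x' \in T & a \in T].
  by rewrite !inE !eqxx ?orbT.
have thT y : (theta y \in T) = (y \in T).
  have eq_theta z w : theta z = w -> (theta y == w) = (y == z).
    by move=> <-; rewrite (inj_eq perm_inj).
  rewrite !inE (eq_theta _ _ tx') (eq_theta _ _ tx) (eq_theta _ _ ta).
  by rewrite (orbC (y == x')).
have nb_theta z : never_bottom D T z -> never_bottom D T (theta z).
  move=> [zT nz]; split; first by rewrite thT.
  move=> W; rewrite -{1}sp => /imsetP[W0 W0D ->].
  by rewrite last_perm_path // (inj_eq perm_inj) nz.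
have [nbx nbx'] : never_bottom D T x /\ never_bottom D T x'.
  have [z nbz] := asp.2 _ (card_triple uT).
  have nbtz := nb_theta _ nbz.
  have := nbz.1; rewrite !inE -orbA => /or3P[] /eqP ez; rewrite ez in nbz nbtz.
  - by rewrite tx in nbtz.
  - by rewrite tx' in nbtz.
  - by have := nbz.2 _ PD; rewrite eP /= eqxx.
have [W WD] := exists_other_bottom mD PD aT xT xa.
have := last_restrict_mem W aT; rewrite {1}/T !inE => + lastW.
rewrite (negPf lastW) orbF => /orP[] /eqP elast.
- have := nbx.2 _ WD; rewrite (last_restrict_default W _ a xT) elast.
  by rewrite eqxx.
- have := nbx'.2 _ WD; rewrite (last_restrict_default W _ a xT) elast.
  by rewrite eqxx.
Qed.
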